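(* Let $G$ be a finitely generated amenable group with finite symmetric generating set $P$, possessing a strictly increasing, tempered Følner sequence $(Q_n)$ of monotiles. Let $p\in\ell^1(G)$ satisfy $0<p(x)<1$ and $p(x)=p(x^{-1})$ for all $x\in G$, and let $(\Omega,\mathcal A,\mathbb P)$ be the associated long-range percolation probability space. Then, almost surely, the set of points of discontinuity of the integrated density of states $N$ equals $$W=\{\lambda\in\mathbb R:\ \text{there exists a finite subgraph } S \text{ of } \Gamma \text{ with } \lambda\in\sigma(\Delta_S)\},$$ where $\Gamma$ is the complete undirected graph with vertex set $G$ and $\sigma(\Delta_S)$ is the spectrum of the Laplacian $\Delta_S$ of $S$.
   Context: Sequences of sets. A Følner sequence is a sequence $(Q_n)$ of nonempty finite subsets of $G$ with $\lim_{n\to\infty}|KQ_n\setminus Q_n|/|Q_n|=0$ for every finite $K\subset G$. It is tempered if there is $C>0$ with $|\bigcup_{k<n}Q_k^{-1}Q_n|\le C|Q_n|$ for all $n$, and strictly increasing if $|Q_{n+1}|>|Q_n|$ for all $n$. A finite set $Q\subset G$ is a monotile of $G$ if there is $T\subset G$ such that $G$ is the disjoint union of the sets $Qt$, $t\in T$. Percolation. Let $E$ be the edge set of the complete undirected graph $\Gamma$ with vertex set $G$; an edge is an unordered pair $[x,y]$ of distinct elements of $G$. Set $\Omega=\{0,1\}^E$, $\mathcal A$ the $\sigma$-algebra generated by cylinder sets, and $\mathbb P=\prod_{e\in E}\mathbb P_e$ the product measure with $\mathbb P_e(\omega(e)=1)=p(xy^{-1})$ and $\mathbb P_e(\omega(e)=0)=1-p(xy^{-1})$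 for $e=[x,y]$. For $\omega\in\Omega$ let $E_\omega=\{e\in E:\omega(e)=1\}$, $\Gamma_\omega=(G,E_\omega)$, and $m_\omega(x)=|\{y\in G:[x,y]\in E_\omega\}|$; almost surely $m_\omega(x)<\infty$ for all $x\in G$. Operators. For finite $Q\subset G$, $\Delta_\omega[Q]$ is the restriction to $\ell^2(Q)$ of the Laplacian of $\Gamma_\omega$: the symmetric matrix indexed by $Q$ with diagonal entries $m_\omega(x)$, entry $-1$ at $(x,y)$ if $[x,y]\in E_\omega$, and $0$ otherwise. For a finite subgraph $S=(V_S,E_S)$ of $\Gamma$, $\Delta_S$ on $\ell^2(V_S)$ is $\Delta_Sf(x)=\sum_{y\in V_S:[x,y]\in E_S}(f(x)-f(y))$. Integrated density of states. For a selfadjoint operator $A$ on a finite dimensional Hilbert space, $n(A)(E)$ is the number of eigenvalues of $A$, counted with multiplicity, that are $\le E$. The integrated density of states $N:\mathbb R\to\mathbb R$ is the non-random function which, for almost every $\omega$, is the limit in supremum norm of $n(\Delta_\omega[Q_j])/|Q_j|$ as $j\to\infty$. Equivalently it is the supremum-norm limit as $n\to\infty$ of $|Q_n|^{-1}\sum_{S}\nu_S\,n(\Delta_S)$, where the sum is over all subgraphs $S=(Q_n,E_S)$ of $\Gamma$ with vertex set $Q_n$ and $\nu_S=\prod_{[x,y]\in E_S}p(xy^{-1})\prod_{[x,y]\in E\setminus E_S,\ x,y\in Q_n}(1-p(xy^{-1}))$. These limits are known to exist and to coincide almost surely. *)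

(* Defs.v *)
From HB Require Import structures.
From mathcomp Require Import all_boot all_order all_algebra.
From mathcomp Require Import finmap.
From mathcomp Require Import all_classical all_reals all_analysis.

Set Implicit Arguments.
Unset Strict Implicit.
Unset Printing Implicit Defensive.

Import Order.TTheory GRing.Theory Num.Theory.
Import numFieldNormedType.Exports.

Local Open Scope classical_set_scope.
Local Open Scope ring_scope.

Section Groups.
Context {R : realType} {G : groupType}.
Implicit Types (A B K P : {fset G}) (Q : nat -> {fset G}).

Definition fset_mul A B : {fset G} := [fset (x * y)%g | x in A, y in B]%fset.

Definition fset_inv A : {fset G} := [fset (x^-1)%g | x in A]%fset.

Definition symmetric_fset P := forall x : G, x \in P -> (x^-1)%g \in P.

(* Words in P alone suffice, because this is only used for symmetric P. *)
Definition generates P :=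
  forall x : G, exists2 s : seq G, {subset s <= P} & x = (\prod_(g <- s) g)%g.

Definition Folner_sequence Q :=
  (forall n, Q n != fset0) /\
  (forall K, (fun n => #|` fset_mul K (Q n) `\` Q n|%fset%:R
                       / #|` Q n|%:R : R) @ \oo --> (0 : R)).

Definition tempered Q :=
  exists2 C : R, 0 < C &
    forall n, #|` \bigcup_(k <- iota 0 n) fset_mul (fset_inv (Q k)) (Q n)|%fset%:R
              <= C * #|` Q n|%:R.

Definition strictly_increasing Q := forall n, (#|` Q n| < #|` Q n.+1|)%N.

Definition monotile A :=
  exists T : set G,
    \bigcup_(t in T) [set (q * t)%g | q in [set` A]] = setT /\
    trivIset T (fun t => [set (q * t)%g | q in [set` A]]).

End Groups.

(* For countable groups, in particular finitely generated ones, amenability is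
   equivalent to the existence of such a sequence. *)
Definition amenable (R : realType) (G : groupType) :=
  exists Q : nat -> {fset G}, @Folner_sequence R G Q.

Definition edge (G : choiceType) := {e : {fset G} | #|` e| == 2%N}.

Section Graphs.
Context {R : realType} {G : choiceType}.

(* Adjacency in the graph with edge set [[set e | w e]].  [[fset x; y]] has two
   elements, i.e. is an edge, exactly when x and y are distinct; otherwise
   [insub] returns [None]. *)
Definition adjacent (w : edge G -> bool) (x y : G) : bool :=
  if insub [fset x; y]%fset is Some e then w e else false.

Definition vertex (V : {fset G}) (i : 'I_#|` V|) : G := tnth (in_tuple V) i.

(* [fset_set] sends infinite sets to the empty one, so the value is 0 when x has
   infinitely many neighbours; for summable edge probabilities this happens only
   on a null set. *)
Definition degree (w : edge G -> bool) (x : G) : nat :=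
  #|` fset_set [set y | adjacent w x y]|.

(* The diagonal carries the degree in the whole graph, not the degree in the
   subgraph induced on Q. *)
Definition restricted_laplacian (w : edge G -> bool) (Q : {fset G}) :
    'M[R]_#|` Q| :=
  \matrix_(i, j)
    if i == j then (degree w (vertex i))%:R
    else if adjacent w (vertex i) (vertex j) then -1 else 0.

Definition is_subgraph (V : {fset G}) (ES : {fset edge G}) :=
  forall e, e \in ES -> (val e `<=` V)%fset.

Definition graph_laplacian (V : {fset G}) (ES : {fset edge G})
    (f : 'rV[R]_#|` V|) : 'rV[R]_#|` V| :=
  \row_i \sum_(j | adjacent (fun e => e \in ES) (vertex i) (vertex j))
           (f 0 i - f 0 j).

Fact graph_laplacian_is_linear V ES : linear (graph_laplacian (V := V) ES).
Proof.
move=> a u v; apply/rowP => i; rewrite !mxE mulr_sumr -big_split /=.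
by apply: eq_bigr => j _; rewrite !mxE mulrBr opprD addrACA.
Qed.

HB.instance Definition _ V ES :=
  GRing.isLinear.Build R _ _ _ (graph_laplacian (V := V) ES)
    (graph_laplacian_is_linear ES).

Definition spectrum (n : nat) (A : 'M[R]_n) : set R := [set a | eigenvalue A a].

Definition finite_subgraph_spectra : set R :=
  [set a | exists (V : {fset G}) (ES : {fset edge G}),
     is_subgraph V ES /\ spectrum (lin1_mx (graph_laplacian (V := V) ES)) a].

End Graphs.

Lemma spectrum_finite (R : realType) (n : nat) (A : 'M[R]_n) :
  finite_set (spectrum A).
Proof.
have A0 : char_poly A != 0 by apply: monic_neq0; exact: char_poly_monic.
apply: contrapT => /(infinite_set_fset (size (char_poly A))) [X XS sX].
have := @max_poly_roots _ (char_poly A) X A0.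
rewrite fset_uniq ltnNge sX => H; suff : false by []; apply: H => //.
by apply/allP => x xX; rewrite -eigenvalue_root_char; exact: (XS x).
Qed.

(* Meaningful for symmetric A: then all eigenvalues are real, and the dimensions
   of the eigenspaces are the multiplicities. *)
Definition eigenvalue_count (R : realType) (n : nat) (A : 'M[R]_n) (E : R) : nat :=
  \big[addn/0%N]_(a \in spectrum A `&` [set a | a <= E]) \rank (eigenspace A a).

Section Percolation.
Context {R : realType} {G : groupType}.

Definition cylinder (F : {fset edge G}) (s : edge G -> bool) :
    set (edge G -> bool) :=
  [set w | forall e, e \in F -> w e = s e].

Definition configurations :=
  g_sigma_algebraType
    [set A : set (edge G -> bool) | exists F s, A = cylinder F s].

(* Reads off p (x y^-1) for the two elements x, y of e in the order in which
   the finite set enumerates them; for symmetric p the order is irrelevant,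
   see [edge_probE]. *)
Definition edge_prob (p : G -> R) (e : edge G) : R :=
  p (nth 1 (val e) 0 * (nth 1 (val e) 1)^-1)%g.

Lemma edge_probE (p : G -> R) (x y : G) (e : edge G) :
  (forall z, p z = p (z^-1)%g) -> val e = [fset x; y]%fset ->
  edge_prob p e = p (x * y^-1)%g.
Proof.
move=> psym ee.
have vE z : (z \in enum_fset (val e)) = (z == x) || (z == y).
  by have -> : (z \in enum_fset (val e)) = (z \in val e) by []; rewrite ee !inE.
have := valP e; have := fset_uniq (val e); move: vE; rewrite /edge_prob /=.
case: (enum_fset _) => [|a [|b [|c s]]] //= vE /andP[aNb _] _.
have := vE a; have := vE b; rewrite !inE !eqxx orbT /=.
move: aNb; rewrite inE => aNb.
move=> /esym/orP[] /eqP bE /esym/orP[] /eqP aE; subst a b.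
- by rewrite eqxx in aNb.
- by rewrite psym invgM invgK.
- by [].
- by rewrite eqxx in aNb.
Qed.

(* The marginals on finite sets of edges determine the product measure. *)
Definition is_product_measure (p : G -> R) (Pr : probability configurations R) :=
  forall (F : {fset edge G}) (s : edge G -> bool),
    Pr (cylinder F s) =
    (\prod_(e <- F) if s e then edge_prob p e else 1 - edge_prob p e)%:E.

Definition is_IDS (Pr : probability configurations R) (Q : nat -> {fset G})
    (N : R -> R) :=
  {ae Pr, forall w : configurations,
    {uniform, (fun j E => (eigenvalue_count (restricted_laplacian w (Q j)) E)%:R
                          / #|` Q j|%:R : R) @ \oo --> N}}.

End Percolation.

Definition discontinuities (R : realType) (N : R -> R) : set R :=
  [set a | ~ {for a, continuous N}].

(* Main.v *)
From HB Require Import structures.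
From Pilot Require Import Defs.
From mathcomp Require Import all_boot all_order all_algebra.
From mathcomp Require Import finmap.
From mathcomp Require Import all_classical all_reals all_analysis.
From mathcomp Require Import measurable_realfun.
From mathcomp Require Import zify lra.
Set Implicit Arguments.
Unset Strict Implicit.
Unset Printing Implicit Defensive.
Import Order.TTheory GRing.Theory Num.Theory.
Import numFieldNormedType.Exports.
(* Gives [adjacent] back its graph-theoretic meaning, which the lemma on
   adjacent sequences of reals hides. *)
Import Pilot.Defs.
Local Open Scope classical_set_scope.
Local Open Scope ring_scope.

(** The discontinuity of N at a is governed by the multiplicities
    [d_j = \rank (eigenspace (restricted_laplacian w (Q j)) a)]: the counting
    function of a symmetric matrix jumps at a by the multiplicity of a, so, the
    convergence being uniform, N is continuous at a as soon as [d_j / |Q j|] is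
    small for one suitable pair (w, j), and conversely continuity of N at a
    forces [d_j / |Q j|] to be almost surely small for large j.

    The restricted Laplacian carries the degrees of the whole random graph.
    Replacing them by the degrees inside [Q j] gives the Laplacian of the finite
    graph induced on [Q j], and perturbs the matrix by a diagonal one whose rank
    is at most the number of vertices of [Q j] with a neighbour outside [Q j]
    ([rank_restricted_laplacian]). Such vertices make up a small proportion of
    [Q j]: an edge from x to a point outside [Q j] either displaces x by an
    element of a fixed finite set K, so that x is one of the few points near the
    boundary of [Q j] ([Folner_interior]); or it is long, which is improbable by
    summability of p and the union bound ([long_edge_event]).

    If a is in no spectrum of a finite subgraph, the induced Laplacian does not
    have the eigenvalue a at all, hence [d_j] is at most the number of those
    vertices ([discontinuities_sub]).

    If a is an eigenvalue of a finite graph S with vertex set V, choose in [Q j]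
    a set of translates V t whose number is a positive fraction of [|Q j|] and
    which are spread out enough for translated eigenfunctions to be linearly
    independent. The probability that the graph induced on [Q j] agrees with the
    translate of S on all edges that touch V t is at least a constant q > 0,
    because an infinite product of factors [1 - p g] with summable p is positive
    ([copy_event_prob_ge]). Each such copy of S is a union of components of the
    induced graph, so it contributes an eigenfunction, and the expectation of
    [d_j / |Q j|] stays away from 0 ([spectra_sub_discontinuities]).

    N being nonrandom, Fatou's lemma ([fatou_indicators]) is what links the
    expectations, where the probabilistic estimates live, to the almost sure
    behaviour of the multiplicities. *)

(** * Eigenvalue counting functions and rank perturbations *)

Lemma eigenvalue_countE (R : realType) (n : nat) (A : 'M[R]_n) (E : R) :
  eigenvalue_count A E =
  (\sum_(a <- fset_set (spectrum A) | (a <= E)%R) \rank (eigenspace A a))%N.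
Proof.
rewrite /eigenvalue_count fsbig_mkcondr fsbig_finite; last first.
  exact: spectrum_finite.
rewrite [RHS]big_mkcond /=; apply: eq_bigr => a _.
rewrite /patch; case: ifPn => [/set_mem/= ->//|].
by case: ifPn => // aE /negP[]; rewrite inE.
Qed.

Lemma notin_spectrum_rank (R : realType) (n : nat) (A : 'M[R]_n) (a : R) :
  ~ spectrum A a -> \rank (eigenspace A a) = 0%N.
Proof. by move=> /negP; rewrite negbK => /eqP ->; rewrite mxrank0. Qed.

(** Stated with the rank of the eigenspace rather than with a in the spectrum:
    the rank vanishes off the spectrum, and no case distinction is left to the
    user. *)
Lemma eigenvalue_count_jump (R : realType) (n : nat) (A : 'M[R]_n) (E a : R) :
  E < a ->
  (eigenvalue_count A E + \rank (eigenspace A a) <= eigenvalue_count A a)%N.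
Proof.
move=> Ea; rewrite !eigenvalue_countE.
rewrite [X in (_ <= X)%N](bigID (fun b => b <= E)) /=.
apply: leq_add.
  rewrite leq_eqVlt; apply/orP; left; apply/eqP; apply: eq_bigl => b.
  by case: (leP b E) => bE; rewrite ?andbF// andbT (ltW (le_lt_trans bE Ea)).
case: (pselect (spectrum A a)) => [aA|/notin_spectrum_rank->//].
rewrite (big_rem a) /=; last first.
  by rewrite in_fset_set ?inE//; exact: spectrum_finite.
by rewrite lexx -ltNge Ea leq_addr.
Qed.

Lemma isolated_in_seq (R : realFieldType) (s : seq R) (a : R) :
  exists2 d : R, 0 < d & forall b, b \in s -> `|b - a| < d -> b = a.
Proof.
elim: s => [|c s [d d0 ds]]; first by exists 1.
have [->|ca] := eqVneq c a.
  by exists d => // b; rewrite inE => /orP[/eqP->|/ds].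
exists (Num.min d `|c - a|); first by rewrite lt_min d0 normr_gt0 subr_eq0.
move=> b; rewrite inE lt_min => /orP[/eqP->|bs]; first by rewrite ltxx andbF.
by move=> /andP[bd _]; exact: ds.
Qed.

(** The spectrum is finite, so near a the counting function only changes by what
    happens at a itself; to the right of a it does not change at all. *)
Lemma eigenvalue_count_near (R : realType) (n : nat) (A : 'M[R]_n) (a : R) :
  exists2 d : R, 0 < d & forall E, `|E - a| < d ->
    `|(eigenvalue_count A E)%:R - (eigenvalue_count A a)%:R|
      <= (\rank (eigenspace A a))%:R :> R.
Proof.
have [d d0 ds] := isolated_in_seq (fset_set (spectrum A)) a.
exists d => // E Ed; rewrite !eigenvalue_countE.
have [aE|Ea] := leP a E.
  rewrite [X in X - _](_ : _ = (\sum_(b <- fset_set (spectrum A) | b <= a)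
      \rank (eigenspace A b))%:R); first by rewrite subrr normr0 ler0n.
  congr (_%:R); rewrite big_seq_cond [RHS]big_seq_cond; apply: eq_bigl => b.
  case: (boolP (b \in _)) => //= bA.
  have [ba|ab] := leP b a; first exact: le_trans ba aE.
  apply/negP => bE; move: (ab); rewrite (ds b bA) ?ltxx//.
  move: Ed; rewrite !ger0_norm ?subr_ge0// ?(ltW ab)//; apply: le_lt_trans.
  by rewrite lerD2r.
rewrite [X in _ - X](_ : _ = (\sum_(b <- fset_set (spectrum A) | b <= E)
    \rank (eigenspace A b))%:R + (\sum_(b <- fset_set (spectrum A) | b == a)
    \rank (eigenspace A b))%:R); last first.
  rewrite -natrD; congr (_%:R).
  rewrite (bigID (fun b => b <= E)) /=; congr (_ + _)%N.
    apply: eq_bigl => b.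
    by case: (leP b E) => bE; rewrite ?andbF// andbT (ltW (le_lt_trans bE Ea)).
  rewrite big_seq_cond [RHS]big_seq_cond; apply: eq_bigl => b.
  case: (boolP (b \in _)) => //= bA; rewrite -ltNge.
  apply/andP/eqP => [[ba Eb]|->]; last by rewrite lexx.
  apply: (ds b bA); move: Ed; rewrite !ler0_norm ?subr_le0// ?(ltW Ea)//.
  by apply: le_lt_trans; rewrite lerN2 lerD2r ltW.
rewrite opprD addrA subrr sub0r normrN ger0_norm ?ler0n// ler_nat.
rewrite big_mkcond /=; case: (boolP (a \in fset_set (spectrum A))) => aA.
  rewrite (bigD1_seq a) ?fset_uniq//; set z := (X in (X <= _)%N).
  rewrite {}/z /= ifT// big1 => [|b /negPf ->//].
  by rewrite addn0.
by rewrite big_seq big1// => b bA; case: eqP => // ba; rewrite -ba bA in aA.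
Qed.

(** Eigenspaces are kernels, and the rank of a matrix is subadditive. *)
Lemma rank_eigenspace_perturbation (R : fieldType) (n : nat) (A B : 'M[R]_n)
    (a : R) :
  (\rank (eigenspace A a) <= \rank (eigenspace B a) + \rank (A - B)%R)%N.
Proof.
have : (\rank (B - a%:M)%R <= \rank (A - a%:M)%R + \rank (A - B)%R)%N.
  rewrite -[\rank (A - B)]mxrank_opp opprB.
  rewrite [B - a%:M](_ : _ = (A - a%:M) + (B - A)) ?mxrank_add//.
  by rewrite [RHS]addrC addrA addrNK.
have := rank_leq_row (B - a%:M).
rewrite !mxrank_ker.
by move: (\rank (B - _)) (\rank (A - _)) (\rank (A - _)) => x y z; lia.
Qed.

Lemma rank_supported_rows (R : fieldType) (m n : nat) (A : 'M[R]_(m, n))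
    (S : pred 'I_m) :
  (forall i, ~~ S i -> row i A = 0) -> (\rank A <= #|S|)%N.
Proof.
move=> A0.
have -> : A = \sum_(i | S i) delta_mx i (0 : 'I_1) *m row i A.
  apply/matrixP => i j; rewrite summxE.
  under eq_bigr do rewrite !mxE big_ord1 !mxE eqxx andbT.
  case: (boolP (S i)) => Si.
    rewrite (bigD1 i)//= eqxx mul1r big1 ?addr0// => k /andP[_ ki].
    by rewrite eq_sym (negPf ki) mul0r.
  rewrite big1; first by have /rowP/(_ j) := A0 _ Si; rewrite !mxE.
  move=> k Sk; case: eqP => [ik|_]; last by rewrite mul0r.
  by rewrite ik Sk in Si.
rewrite -sum1_card; elim/big_rec2: _ => [|i n' B _ Bn].
  by rewrite mxrank0.
apply: leq_trans (mxrank_add _ _) _; apply: leq_add Bn.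
by apply: leq_trans (mxrankM_maxr _ _) (rank_leq_row _).
Qed.

(** * Laplacians of finite induced graphs *)

Section FiniteGraphs.
Context {R : realType} {G : choiceType}.
Implicit Types (w : edge G -> bool) (V Q : {fset G}) (ES : {fset edge G}).

Lemma adjacentP w (x y : G) :
  reflect (exists2 e : edge G, val e = [fset x; y]%fset & w e) (adjacent w x y).
Proof.
rewrite /adjacent; case: insubP => [e _ ee|xy]; apply: (iffP idP) => //.
- by exists e.
- by case=> e' e'e we'; rewrite (_ : e = e')//; apply/val_inj; rewrite ee.
- by case=> e ee _; case/negP: xy; rewrite -ee (valP e).
Qed.

Lemma adjacent_edge w (e : edge G) (x y : G) :
  val e = [fset x; y]%fset -> adjacent w x y = w e.
Proof.
move=> ee; apply/adjacentP/idP => [[e' e'e we']|we]; last by exists e.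
by rewrite (_ : e = e')//; apply/val_inj; rewrite ee.
Qed.

Lemma adjacentC w (x y : G) : adjacent w x y = adjacent w y x.
Proof. by rewrite /adjacent fsetUC. Qed.

Lemma adjacentxx w (x : G) : adjacent w x x = false.
Proof.
apply/adjacentP => -[e ee _]; have := valP e.
by rewrite /= ee fsetUid cardfs1.
Qed.

(** Together with the vertex set Q this is the subgraph induced on Q. *)
Definition edges_within w Q : {fset edge G} :=
  [fset e in (pmap insub (fpowerset Q) : seq (edge G)) | w e]%fset.

Lemma in_edges_within w Q (e : edge G) :
  (e \in edges_within w Q) = (val e `<=` Q)%fset && w e.
Proof. by rewrite !inE /= mem_pmap_sub fpowersetE. Qed.

Lemma adjacent_within w Q (x y : G) : x \in Q -> y \in Q ->
  adjacent (fun e => e \in edges_within w Q) x y = adjacent w x y.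
Proof.
move=> xQ yQ; apply/adjacentP/adjacentP => -[e ee we]; exists e => //.
  by move: we; rewrite in_edges_within => /andP[].
rewrite in_edges_within we ee andbT.
by apply/fsubsetP => z; rewrite !inE => /orP[] /eqP->.
Qed.

Lemma vertex_in V (i : 'I_#|` V|) : vertex i \in V.
Proof. exact: mem_tnth. Qed.

Lemma vertex_inj V : injective (@vertex G V).
Proof.
move=> i j /eqP; rewrite /vertex !(tnth_nth (vertex i))/=.
by rewrite nth_uniq ?fset_uniq ?ltn_ord// => /eqP/val_inj.
Qed.

Lemma vertex_surj V (x : G) : x \in V -> exists i : 'I_#|` V|, vertex i = x.
Proof. by move=> xV; have /tnthP[i ->] : x \in in_tuple V := xV; exists i. Qed.

Lemma big_vertex (S : Type) (idx : S) (op : Monoid.com_law idx) V (P : pred G)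
    (F : G -> S) :
  \big[op/idx]_(j < #|` V| | P (vertex j)) F (vertex j) =
  \big[op/idx]_(x <- V | P x) F x.
Proof. by rewrite [RHS]big_tnth. Qed.

Lemma laplacian_matrixE V ES (i j : 'I_#|` V|) :
  lin1_mx (graph_laplacian (R := R) (V := V) ES) i j =
  if i == j then
    (\sum_(y <- V | adjacent (fun e => e \in ES) (vertex i) y) 1)%N%:R
  else if adjacent (fun e => e \in ES) (vertex i) (vertex j) then -1 else 0.
Proof.
rewrite !mxE; case: (eqVneq i j) => [->|ij].
  rewrite -big_vertex natr_sum; apply: eq_bigr => k jk; rewrite !mxE !eqxx.
  case: eqP => [kj|]; last by rewrite subr0.
  by move: jk; rewrite kj adjacentxx.
rewrite adjacentC.
under eq_bigr do rewrite !mxE eqxx /= sub0r.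
case: ifPn => ji; last first.
  rewrite big1// => k jk; case: eqP => [ki|]; last by rewrite oppr0.
  by rewrite -ki jk in ji.
rewrite (bigD1 i)//= eqxx big1 ?addr0// => k /andP[_ /negPf ->].
by rewrite oppr0.
Qed.

Lemma laplacian_mulE V ES (f : G -> R) (i : 'I_#|` V|) :
  ((\row_j f (vertex j)) *m lin1_mx (graph_laplacian (V := V) ES)) 0 i =
  \sum_(y <- V | adjacent (fun e => e \in ES) (vertex i) y)
    (f (vertex i) - f y).
Proof.
rewrite mul_rV_lin1 mxE -big_vertex; apply: eq_bigr => j _.
by rewrite !mxE.
Qed.

(** Functions on the whole of G replace row vectors indexed by the enumeration
    of V, which makes translation and extension by zero harmless. *)
Definition eigenfunction_on V ES (a : R) (f : G -> R) :=
  forall x, x \in V ->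
    \sum_(y <- V | adjacent (fun e => e \in ES) x y) (f x - f y) = a * f x.

Lemma spectrum_eigenfunction V ES (a : R) :
  spectrum (lin1_mx (graph_laplacian (V := V) ES)) a ->
  exists f : G -> R, [/\ forall x, x \notin V -> f x = 0,
    exists2 v, v \in V & f v != 0 & eigenfunction_on V ES a f].
Proof.
case/eigenvalueP => u /rowP ue u0.
pose f x := \sum_(i < #|` V| | vertex i == x) u 0 i.
have fE i : f (vertex i) = u 0 i.
  rewrite /f (bigD1 i)//= big1 ?addr0// => k /andP[/eqP/vertex_inj->].
  by rewrite eqxx.
exists f; split.
- move=> x xV; rewrite /f big1// => i /eqP ix.
  by move: xV; rewrite -ix vertex_in.
- have /existsP[i ui] : [exists i, u 0 i != 0].
    apply: contraNT u0 => /existsPn u0; apply/eqP/rowP => i; rewrite mxE.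
    by have /negPn/eqP := u0 i.
  by exists (vertex i); rewrite ?vertex_in ?fE.
- move=> _ /vertex_surj[i <-]; rewrite -laplacian_mulE fE.
  rewrite -[RHS](_ : (a *: u) 0 i = _) ?mxE//.
  have := ue i; rewrite !mxE => <-; apply: eq_bigr => k _.
  by rewrite mxE fE.
Qed.

(** The points [c t] separate the functions: evaluating the [t]-th function at
    the points [c t'] gives an invertible diagonal matrix, whence linear
    independence. *)
Lemma rank_eigenspace_family Q ES (a : R) (T : {fset G}) (u : G -> G -> R)
    (c : G -> G) :
  {in T, forall t, eigenfunction_on Q ES a (u t)} ->
  {in T, forall t, c t \in Q} -> {in T, forall t, u t (c t) != 0} ->
  {in T &, forall t t', t != t' -> u t (c t') = 0} ->
  (#|` T| <= \rank (eigenspace (lin1_mx (graph_laplacian (V := Q) ES)) a))%N.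
Proof.
move=> ue cQ uc0 uc.
pose U := \matrix_(i < #|` T|, j < #|` Q|) u (vertex i) (vertex j).
have Ufree : row_free U.
  apply/row_freeP; exists (\matrix_(j < #|` Q|, i < #|` T|)
    (if vertex j == c (vertex i) then (u (vertex i) (vertex j))^-1 else 0)).
  apply/matrixP => i i'; rewrite !mxE.
  have [k kE] := vertex_surj (cQ _ (vertex_in i')).
  rewrite (bigD1 k)//= !mxE kE eqxx big1 => [|k' k'k]; last first.
    rewrite !mxE; case: eqP => [k'E|]; last by rewrite mulr0.
    by move: k'k; rewrite -kE in k'E; rewrite (vertex_inj k'E) eqxx.
  rewrite addr0; have [->|ii'] := eqVneq i i'.
    by rewrite mulfV// uc0 ?vertex_in.
  by rewrite uc ?vertex_in ?mul0r// (inj_eq (@vertex_inj T)).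
have /eqP <- := Ufree; apply: mxrankS; apply/eigenspaceP.
apply/row_matrixP => i; rewrite row_mul linearZ/=.
rewrite (_ : row i U = \row_j u (vertex i) (vertex j)); last first.
  by apply/rowP => j; rewrite !mxE.
apply/rowP => j; rewrite laplacian_mulE ue ?vertex_in//.
by rewrite !mxE.
Qed.

(** The vertices whose degree in the whole graph may differ from their degree in
    the graph induced on Q. *)
Definition leaking w Q : {fset G} :=
  [fset x in Q | `[< exists2 y, y \notin Q & adjacent w x y >]]%fset.

(** A vertex without neighbours outside Q has finitely many neighbours, so the
    default value of [degree] for infinite neighbourhoods does not interfere. *)
Lemma degree_within w Q (x : G) : x \in Q -> x \notin leaking w Q ->
  degree w x = (\sum_(y <- Q | adjacent w x y) 1)%N.
Proof.
rewrite !inE /= => xQ; rewrite xQ/= => /asboolPn xl.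
rewrite /degree (_ : [set y | _] = [set` [fset y in Q | adjacent w x y]%fset]).
  by rewrite set_fsetK card_fset_sum1/= big_fset.
apply/seteqP; split => y /=; last by rewrite !inE /= => /andP[].
move=> xy; rewrite !inE /= xy andbT; apply: contrapT => /negP yQ.
by apply: xl; exists y.
Qed.

(** Off the diagonal the two matrices agree, and on the diagonal they compare
    the two degrees. *)
Lemma rank_restricted_laplacian w Q :
  (\rank (restricted_laplacian w Q -
     lin1_mx (graph_laplacian (R := R) (V := Q) (edges_within w Q)))%R
   <= #|` leaking w Q|)%N.
Proof.
apply: (@leq_trans #|[pred i : 'I_#|` Q| | vertex i \in leaking w Q]|).
  apply: rank_supported_rows => i /= il; apply/rowP => j.
  rewrite [LHS]mxE [LHS]mxE [X in _ + X]mxE laplacian_matrixE.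
  rewrite [X in X + _]mxE mxE.
  rewrite !adjacent_within ?vertex_in//.
  case: eqVneq => [_|_]; last by rewrite subrr.
  rewrite (degree_within (vertex_in i) il).
  rewrite big_seq_cond [X in _ - X%:R]big_seq_cond.
  rewrite [X in _ - X%:R](eq_bigl
    (fun y => (y \in Q) && adjacent w (vertex i) y)).
    by rewrite subrr.
  move=> y; case: (boolP (y \in Q)) => // yQ.
  by rewrite adjacent_within ?vertex_in.
rewrite -sum1_card (big_vertex _ _ (mem (leaking w Q)) (fun=> 1%N)).
rewrite sum1_count -size_filter; apply: uniq_leq_size => [|x].
  exact/filter_uniq/fset_uniq.
by rewrite mem_filter => /andP[].
Qed.

End FiniteGraphs.

(** * Translated subgraphs, spread-out sets and interiors of Foelner sets *)

Section TranslatedSubgraphs.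
Context {R : realType} {G : groupType}.

Lemma subgraph_adjacent (V : {fset G}) (ES : {fset edge G}) (x y : G) :
  is_subgraph V ES -> adjacent (fun e => e \in ES) x y ->
  (x \in V) && (y \in V).
Proof.
move=> VES /adjacentP[e ee /VES/fsubsetP eV].
by rewrite !eV// ee !inE eqxx ?orbT.
Qed.

(** No edge of the induced graph joins V t to its complement, so the translated
    function, extended by zero, satisfies the eigenvalue equation at the points
    of V t because f does on V, and elsewhere trivially. *)
Lemma eigenfunction_translate (V Q : {fset G}) (ES : {fset edge G}) (a : R)
    (f : G -> R) (t : G) (w : edge G -> bool) :
  is_subgraph V ES -> eigenfunction_on V ES a f ->
  (forall x, x \notin V -> f x = 0) -> {in V, forall v, (v * t)%g \in Q} ->
  (forall x y, (x * t^-1)%g \in V -> y \in Q ->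
    adjacent w x y =
    adjacent (fun e => e \in ES) (x * t^-1)%g (y * t^-1)%g) ->
  eigenfunction_on Q (edges_within w Q) a (fun x => f (x * t^-1)%g).
Proof.
move=> VES fa f0 VtQ wES x xQ.
rewrite [LHS](_ : _ = \sum_(y <- Q | adjacent w x y)
    (f (x * t^-1)%g - f (y * t^-1)%g)); last first.
  rewrite big_seq_cond [RHS]big_seq_cond; apply: eq_bigl => y.
  by case: (boolP (y \in Q)) => //= yQ; rewrite adjacent_within.
have [xV|xV] := boolP ((x * t^-1)%g \in V); last first.
  rewrite f0// mulr0 big_seq_cond big1// => y /andP[yQ xy].
  rewrite f0 ?subrr//; apply/negP => yV.
  move: xy; rewrite adjacentC wES// => /(subgraph_adjacent VES)/andP[_].
  by apply/negP.
rewrite -fa// -big_filter -[RHS]big_filter.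
set r := [seq y <- V | _]; pose rt := [seq (z * t)%g | z <- r].
transitivity (\sum_(y <- rt) (f (x * t^-1)%g - f (y * t^-1)%g)); last first.
  by rewrite big_map; apply: eq_bigr => z _; rewrite mulgK.
apply/perm_big/uniq_perm.
- exact/filter_uniq/fset_uniq.
- by rewrite map_inj_uniq; [exact/filter_uniq/fset_uniq | exact: mulIg].
move=> y; rewrite mem_filter; apply/andP/mapP => [[xy yQ]|[z]].
  exists (y * t^-1)%g; last by rewrite mulgVK.
  rewrite mem_filter; move: xy; rewrite wES// => xy.
  by have /andP[_ yV] := subgraph_adjacent VES xy; apply/andP.
rewrite mem_filter => /andP[xz zV] ->; have ztQ := VtQ _ zV.
by split => //; rewrite wES// mulgK.
Qed.

End TranslatedSubgraphs.

(** Greedy choice: each chosen point discards at most m points of X, itself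
    included. *)
Lemma independent_fset (T : choiceType) (conf : rel T) (m : nat)
    (X : {fset T}) :
  symmetric conf ->
  {in X, forall x, (#|` [fset y in X | (y == x) || conf x y]%fset| <= m)%N} ->
  exists S : {fset T}, [/\ (S `<=` X)%fset,
    {in S &, forall x y, x != y -> ~~ conf x y} & (#|` X| <= m * #|` S|)%N].
Proof.
move=> confC; have [n] := ubnP #|` X|; elim: n X => // n IH X Xn Xm.
have [->|/fset0Pn[x xX]] := eqVneq X fset0.
  by exists fset0; rewrite fsub0set cardfs0; split => // y; rewrite inE.
pose N := [fset y in X | (y == x) || conf x y]%fset.
have NX : (N `<=` X)%fset by apply/fsubsetP => y; rewrite !inE => /andP[].
have xN : x \in N by rewrite !inE /= xX eqxx.
have N0 : (0 < #|` N|)%N by rewrite cardfs_gt0; apply/fset0Pn; exists x.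
have XN : #|` X| = (#|` N| + #|` (X `\` N)%fset|)%N.
  by rewrite cardfsD (fsetIidPr NX) subnKC// fsubset_leq_card.
have [||S [SX Sconf XS]] := IH (X `\` N)%fset.
- by rewrite -ltnS; apply: leq_trans Xn; rewrite ltnS XN; lia.
- move=> y /fsetDP[yX _]; apply: leq_trans (Xm y yX); apply: fsubset_leq_card.
  by apply/fsubsetP => z; rewrite !inE => /andP[/andP[_ ->] ->].
have SE y : y \in S -> (y != x) && ~~ conf x y.
  move=> /(fsubsetP SX); rewrite !inE /= => /andP[+ yX].
  by rewrite yX /= negb_or.
exists (x |` S)%fset; split.
- rewrite fsubUset fsub1set xX /=; apply: fsubset_trans SX _; exact: fsubsetDl.
- move=> y z; rewrite !inE => /orP[/eqP->|yS] /orP[/eqP->|zS]; rewrite ?eqxx//.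
  + by have /andP[] := SE _ zS.
  + by rewrite confC; have /andP[] := SE _ yS.
  + exact: Sconf.
- rewrite cardfsU1 (_ : x \notin S) ?mulnDr ?muln1 ?XN ?leq_add//=; last first.
    by apply/negP => /SE; rewrite eqxx.
  exact: Xm.
Qed.

Definition interior_points (G : groupType) (K Q : {fset G}) : {fset G} :=
  [fset x in Q | all (fun k => (k * x)%g \in Q) K]%fset.

(** A point x of Q outside the interior is [k^-1 y] for some k in K and
    y in K Q but not in Q, so there are at most [|K| |KQ minus Q|] of them. *)
Lemma Folner_interior (R : realType) (G : groupType) (Q : nat -> {fset G})
    (K : {fset G}) (d : R) : Folner_sequence (R := R) Q -> 0 < d ->
  \forall n \near \oo,
    #|` Q n `\` interior_points K (Q n)|%fset%:R <= d * #|` Q n|%:R.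
Proof.
move=> [Q0 Qlim] d0.
have b n : (#|` (Q n `\` interior_points K (Q n))%fset|
            <= #|` K| * #|` (fset_mul K (Q n) `\` Q n)%fset|)%N.
  rewrite -(size_allpairs (fun k y => (k^-1 * y)%g)); apply: uniq_leq_size.
    exact: fset_uniq.
  move=> x /fsetDP[xQ]; rewrite !inE /= xQ /= => /allPn[k kK kxQ].
  apply/allpairsP; exists (k, (k * x)%g); rewrite /= mulKg; split => //.
  by apply/fsetDP; split => //; apply/imfset2P; exists k => //; exists x.
(* The extra 1 covers the case of an empty K. *)
have K0 : 0 < (#|` K|%:R + 1 : R) by rewrite ltr_wpDl.
near=> n.
have Qn0 : 0 < (#|` Q n|%:R : R) by rewrite ltr0n cardfs_gt0.
apply: (@le_trans _ _ (#|` K|%:R * #|` fset_mul K (Q n) `\` Q n|%fset%:R)).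
  by rewrite -natrM ler_nat.
apply: (@le_trans _ _ (#|` K|%:R * (d / (#|` K|%:R + 1) * #|` Q n|%:R))).
  rewrite ler_wpM2l// -ler_pdivrMr//.
  rewrite -[leLHS]ger0_norm ?divr_ge0//.
  by near: n; apply: cvgr0_norm_le (Qlim K) _ _; rewrite divr_gt0.
rewrite mulrA ler_wpM2r// mulrCA ler_piMr ?(ltW d0)//.
by rewrite ler_pdivrMr// mul1r lerDl.
Unshelve. all: by end_near. Qed.

(** * Summability, union bounds and Fatou for sums of indicators *)

Lemma eq_big_fset_cond (S : Type) (idx : S) (op : Monoid.com_law idx)
    (T : choiceType) (A B : {fset T}) (P P' : pred T) (F : T -> S) :
  (forall x, (x \in A) && P x = (x \in B) && P' x) ->
  \big[op/idx]_(x <- A | P x) F x = \big[op/idx]_(x <- B | P' x) F x.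
Proof.
move=> AB; rewrite -big_filter -[RHS]big_filter; apply/perm_big/uniq_perm.
- exact/filter_uniq/fset_uniq.
- exact/filter_uniq/fset_uniq.
- by move=> x; rewrite !mem_filter andbC AB andbC.
Qed.

Lemma prod_one_minus_ge (R : realDomainType) (I : eqType) (s : seq I)
    (p : I -> R) :
  {in s, forall i, 0 <= p i <= 1} ->
  1 - \sum_(i <- s) p i <= \prod_(i <- s) (1 - p i).
Proof.
elim: s => [|i s IH] ps; first by rewrite !big_nil subr0.
have p01 j : j \in s -> 0 <= p j <= 1.
  by move=> js; apply: ps; rewrite inE js orbT.
have /andP[pi0 pi1] : 0 <= p i <= 1 by apply: ps; rewrite inE eqxx.
have S0 : 0 <= \sum_(j <- s) p j.
  by rewrite big_seq sumr_ge0// => j /p01/andP[].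
rewrite !big_cons.
apply: (@le_trans _ _ ((1 - p i) * (1 - \sum_(j <- s) p j))).
  by rewrite mulrBr mulr1 mulrBl mul1r; have := mulr_ge0 pi0 S0; lra.
by rewrite ler_wpM2l ?subr_ge0//; exact: IH.
Qed.

(** The total sum is a supremum over finite sets; take for K a set whose sum
    comes within d of it. *)
Lemma summable_tail (R : realType) (T : choiceType) (p : T -> R) (d : R) :
  (forall x, 0 <= p x) -> summable [set: T] (fun x => (p x)%:E) -> 0 < d ->
  exists K : {fset T}, forall F : {fset T}, \sum_(x <- F | x \notin K) p x <= d.
Proof.
move=> p0; rewrite summableE => psum d0.
have pE : (fun x => `|(p x)%:E|)%E = (fun x => (p x)%:E).
  by apply/funext => x; rewrite gee0_abs ?lee_fin.
rewrite {}pE in psum.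
have [_ [X [fX _] <-]] := ub_ereal_sup_adherent d0 psum.
rewrite -/(esum _ _); set S := esum _ _ in psum *.
rewrite fsbig_finite//=; set K := fset_set X => SK.
exists K => F.
have : (\sum_(x <- (K `|` F)%fset) (p x)%:E <= S)%E.
  apply: ereal_sup_ubound; exists [set` (K `|` F)%fset].
    by split => //; exact: finite_fset.
  by rewrite fsbig_finite ?set_fsetK//; exact: finite_fset.
move: SK; rewrite !sumEFin -(fineK psum) -EFinB lte_fin lee_fin.
rewrite [X in X <= _ -> _](bigID (mem K))/=.
have -> : \sum_(x <- (K `|` F)%fset | x \in K) p x = \sum_(x <- K) p x.
  apply: eq_big_fset_cond => x; rewrite !inE.
  by case: (x \in K) => /=; rewrite ?andbT ?andbF.
have -> : \sum_(x <- (K `|` F)%fset | x \notin K) p x =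
          \sum_(x <- F | x \notin K) p x.
  apply: eq_big_fset_cond => x; rewrite !inE.
  by case: (x \in K) => /=; rewrite ?andbT ?andbF.
by move=> SK SKF; lra.
Qed.

Section MeasureLemmas.
Context d (T : measurableType d) (R : realType).

(** Union bound in a form that only mentions finite sums, so that it can be fed
    with [summable_tail]; e need not be injective, as the finite unions are
    indexed by finite sets rather than by initial segments of e. *)
Lemma measure_union_le (mu : {measure set T -> \bar R}) (I : choiceType)
    (e : nat -> I) (A : I -> set T) (c : \bar R) :
  (forall i, exists n, e n = i) -> (forall i, measurable (A i)) ->
  (forall F : {fset I}, (\sum_(i <- F) mu (A i) <= c)%E) ->
  (mu (\bigcup_i A i) <= c)%E.
Proof.
move=> esurj mA Ac.
pose E n := seq_fset tt [seq e k | k <- iota 0 n].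
have EP n i : reflect (exists2 k, (k < n)%N & i = e k) (i \in E n).
  rewrite seq_fsetE; apply: (iffP mapP) => -[k kn ->]; exists k => //;
    by move: kn; rewrite mem_iota.
pose D n := \bigcup_(i in [set` E n]) A i.
have mD n : measurable (D n).
  by apply: fin_bigcup_measurable => //; exact: finite_fset.
have -> : \bigcup_i A i = \bigcup_n D n.
  apply/seteqP; split => [w [i _ Aiw]|w [n _ [i _ Aiw]]]; last by exists i.
  have [n ni] := esurj i; exists n.+1 => //; exists i => //=.
  by apply/EP; exists n.
have Dc n : (mu (D n) <= c)%E.
  apply: le_trans (Ac (E n)).
  have -> : (\sum_(i <- E n) mu (A i) = \sum_(i \in [set` E n]) mu (A i))%E.
    by rewrite fsbig_finite ?set_fsetK//; exact: finite_fset.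
  by apply: content_sub_fsum => //; exact: finite_fset.
have cvgD : mu \o D @ \oo --> mu (\bigcup_n D n).
  apply: nondecreasing_cvg_mu => //; first exact: bigcupT_measurable.
  move=> n m nm; apply/subsetPset => w [i /= /EP[k kn ->] Aw].
  by exists (e k) => //=; apply/EP; exists k => //; exact: leq_trans nm.
by apply: cvge_le cvgD; exact: nearW.
Qed.

(** Fatou's lemma for the normalised numbers of events that occur: an eventual
    almost sure lower bound cannot exceed an eventual upper bound for the
    expectations. The constants [c j] absorb deterministic error terms. *)
Lemma fatou_indicators (P : probability T R) (s : nat -> seq (set T))
    (c m : nat -> R) (a b : R) :
  (forall j A, A \in s j -> measurable A) -> (forall j, 0 <= c j) ->
  (forall j, 0 <= m j) -> 0 <= a ->
  {ae P, forall w, \forall j \near \oo,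
     a <= c j + (\sum_(A <- s j) \1_A w) / m j} ->
  (\forall j \near \oo, c j + (\sum_(A <- s j) fine (P A)) / m j <= b) ->
  a <= b.
Proof.
move=> ms c0 m0 a0 aeP leb.
pose h j w : \bar R := ((c j)%:E + (m j)^-1%:E * \sum_(A <- s j) (\1_A w)%:E)%E.
have hE j w : h j w = (c j + (\sum_(A <- s j) \1_A w) / m j)%:E.
  by rewrite /h sumEFin EFinD mulrC EFinM.
have h0 j w : (0 <= h j w)%E.
  by rewrite hE lee_fin addr_ge0// divr_ge0// sumr_ge0.
have mS A j : A \in s j -> measurable_fun setT (fun w => (\1_A w)%:E : \bar R).
  by move=> /ms mA; apply/measurable_EFinP; exact: measurable_indic.
have mSum j : measurable_fun setT
    (fun w => \sum_(A <- s j) (\1_A w)%:E : \bar R)%E.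
  rewrite (_ : (fun w => _) = (fun w => \sum_(i < size (s j))
     (\1_(tnth (in_tuple (s j)) i) w)%:E)%E); last first.
    by apply/funext => w; rewrite big_tnth.
  by apply: emeasurable_sum => i; apply: (mS _ j); exact: mem_tnth.
have mh j : measurable_fun setT (h j).
  by apply: emeasurable_funD => //; exact: measurable_funeM.
have inth j : (\int[P]_w h j w)%E =
    (c j + (\sum_(A <- s j) fine (P A)) / m j)%:E.
  have Sum0 w : (0 <= \sum_(A <- s j) (\1_A w)%:E :> \bar R)%E.
    by apply: sume_ge0 => A _; rewrite lee_fin.
  have mi : (0 <= ((m j)^-1)%:E :> \bar R)%E by rewrite lee_fin invr_ge0.
  rewrite ge0_integralD//; last 3 first.
  - by move=> w _; rewrite lee_fin.
  - by move=> w _; rewrite mule_ge0.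
  - exact: measurable_funeM.
  have -> : (\int[P]__ (c j)%:E = (c j)%:E)%E.
    by rewrite -[RHS]mule1 -(probability_setT P); exact: integral_cst.
  rewrite ge0_integralZl//.
  under eq_integral do rewrite big_tnth.
  rewrite ge0_integral_sum//; last first.
    by move=> i; apply: (mS _ j); exact: mem_tnth.
  rewrite EFinD; congr (_ + _)%E; rewrite [in RHS]mulrC EFinM; congr (_ * _)%E.
  rewrite [in RHS]big_tnth -sumEFin; apply: eq_bigr => i _.
  have mA : measurable (tnth (in_tuple (s j)) i).
    by apply: (ms j); exact: mem_tnth.
  by rewrite integral_indic// setIT fineK// fin_num_measure.
have ml : measurable_fun setT (fun w => limn_einf (h^~ w)).
  apply: (emeasurable_fun_cvg (fun n w => einfs (h^~ w) n)).
    by move=> n; exact: measurable_fun_einfs.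
  by move=> w _; rewrite limn_einf_lim; exact: is_cvg_einfs.
rewrite -lee_fin; have <- : (\int[P]_(w in setT) cst a%:E w = a%:E)%E.
  by rewrite -[RHS]mule1 -(probability_setT P); exact: integral_cst.
apply: (@le_trans _ _ (\int[P]_w limn_einf (h^~ w))%E).
  apply: ae_ge0_le_integral => //.
  - move=> w _; rewrite limn_einf_lim.
    apply: lime_ge; first exact: is_cvg_einfs.
    by apply: nearW => n; apply: le_ereal_inf_tmp => _ [k _ <-].
  - move: aeP; apply: filterS => w [N _ wN] _.
    rewrite limn_einf_lim; apply: lime_ge; first exact: is_cvg_einfs.
    exists N => // n /= Nn; apply: le_ereal_inf_tmp => _ [k /= nk <-].
    by rewrite hE lee_fin; apply: wN => /=; exact: leq_trans nk.
apply: le_trans (fatou P measurableT mh (fun n w _ => h0 n w)) _.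
rewrite limn_einf_lim; apply: lime_le; first exact: is_cvg_einfs.
case: leb => N _ leb; exists N => // n /= Nn.
apply: (@le_trans _ _ (\int[P]_w h n w)%E).
  by apply: ereal_inf_lbound; exists n => /=.
by rewrite inth lee_fin; exact: leb.
Qed.

End MeasureLemmas.

(** * Probabilities of edge configurations *)

(** A finitely generated group is countable: enumerate the words in P. *)
Lemma generated_enumeration (G : groupType) (P : {fset G}) : generates P ->
  exists e : nat -> G, forall x, exists n, e n = x.
Proof.
move=> genP.
exists (fun n => if choice.unpickle n is Some s
  then (\prod_(g <- s : seq P) val g)%g else 1%g) => x.
have [s sP ->] := genP x; exists (choice.pickle (pmap insub s : seq P)).
rewrite choice.pickleK -(big_map val xpredT id) /=; congr (bigop _ _ _).
rewrite (pmap_filter (insubK _)); apply/all_filterP/allP => g gs.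
by rewrite isSome_insub; exact: sP.
Qed.

Section EdgeProbabilities.
Context {R : realType} {G : groupType}.
Variables (p : G -> R) (Pr : probability (@configurations G) R).
Hypothesis p_bounds : forall x, 0 < p x < 1.
Hypothesis p_symmetric : forall x, p x = p (x^-1)%g.
Hypothesis Pr_product : is_product_measure p Pr.

Let p_ge0 x : 0 <= p x.
Proof. by have /andP[/ltW] := p_bounds x. Qed.

Lemma measurable_cylinder (F : {fset edge G}) (s : edge G -> bool) :
  measurable (cylinder F s : set (@configurations G)).
Proof. by apply: sub_sigma_algebra; exists F, s. Qed.

Lemma adjacent_cylinder (e : edge G) (x y : G) : val e = [fset x; y]%fset ->
  [set w | adjacent w x y] = cylinder [fset e]%fset (fun=> true).
Proof.
move=> ee; apply/seteqP; split => w xy.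
  move=> e'; rewrite inE => /eqP->.
  exact: etrans (esym (adjacent_edge w ee)) xy.
exact: etrans (adjacent_edge w ee) (xy e (fset11 e)).
Qed.

Lemma pair_edge (x y : G) : x != y ->
  exists e : edge G, val e = [fset x; y]%fset.
Proof.
move=> xy; have xy2 : #|` [fset x; y]%fset| == 2%N by rewrite cardfs2 xy.
by exists (exist (fun e : {fset G} => #|` e| == 2%N) _ xy2).
Qed.

Lemma adjacent_event (x y : G) :
  measurable ([set w | adjacent w x y] : set (@configurations G)) /\
  (Pr [set w | adjacent w x y] <= (p (x * y^-1)%g)%:E)%E.
Proof.
have [->|/pair_edge[e ee]] := eqVneq x y.
  have -> : [set w | adjacent w y y] = set0 :> set (edge G -> bool).
    by apply/seteqP; split => w //=; rewrite adjacentxx.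
  by split; [exact: measurable0|rewrite measure0 lee_fin].
rewrite (adjacent_cylinder ee); split; first exact: measurable_cylinder.
by rewrite Pr_product big_seq_fset1 (edge_probE p_symmetric ee).
Qed.

(** K is the set of displacements that count as short. *)
Definition long_edge (K : {fset G}) (x : G) : set (@configurations G) :=
  [set w | exists2 y, (x * y^-1)%g \notin K & adjacent w x y].

(** Union bound over the displacements outside K. *)
Lemma long_edge_event (P : {fset G}) (K : {fset G}) (d : R) (x : G) :
  generates P -> (forall F : {fset G}, \sum_(g <- F | g \notin K) p g <= d) ->
  measurable (long_edge K x) /\ (Pr (long_edge K x) <= d%:E)%E.
Proof.
move=> /generated_enumeration[e esurj] tail.
pose A g := if g \in K then set0
  else [set w : @configurations G | adjacent w x (g^-1 * x)%g].
have mA g : measurable (A g).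
  by rewrite /A; case: ifP => // _; exact: (adjacent_event _ _).1.
have -> : long_edge K x = \bigcup_g A g.
  apply/seteqP; split => w [].
    move=> y xyK xy; exists (x * y^-1)%g => //; rewrite /A (negPf xyK) /=.
    by rewrite invgM invgK mulgVK.
  move=> g _; rewrite /A; case: ifPn => // gK /= xg.
  by exists (g^-1 * x)%g => //; rewrite invgM invgK mulVKg.
split.
  rewrite (_ : \bigcup_g A g = \bigcup_n A (e n)).
    exact: bigcupT_measurable.
  apply/seteqP; split => w [i _ Aw]; last by exists (e i).
  by have [n ni] := esurj i; exists n => //; rewrite ni.
apply: (measure_union_le esurj mA) => F.
apply: le_trans (_ : ((\sum_(g <- F | g \notin K) p g)%:E <= _)%E); last first.
  by rewrite lee_fin.
rewrite -sumEFin [X in (_ <= X)%E]big_mkcond/=; apply: lee_sum => g _.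
rewrite /A; case: ifP => [_|_]; first by rewrite measure0.
apply: le_trans (adjacent_event _ _).2 _.
by rewrite invgM invgK mulVKg.
Qed.

Let edge_prob_bounds e : 0 < edge_prob p e < 1.
Proof. exact: p_bounds. Qed.

Definition edge_weight (s : edge G -> bool) (e : edge G) :=
  if s e then edge_prob p e else 1 - edge_prob p e.

Lemma edge_weight01 s e : 0 <= edge_weight s e <= 1.
Proof.
by have /andP[] := edge_prob_bounds e; rewrite /edge_weight; case: ifP; lra.
Qed.

Lemma other_end (e : edge G) (x : G) : x \in val e ->
  exists y, val e = [fset x; y]%fset.
Proof.
move=> xe; have := valP e; rewrite /= (cardfsD1 x) xe => /cardfs1P[y yE].
by exists y; rewrite -(fsetD1K xe) yE.
Qed.

(** Every edge of F has an end in X, and the factors are at most 1, so the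
    product can only decrease when it is taken over all pairs of an x in X and
    an edge of F at x. For one x the edges to y are distinguished by [x y^-1],
    so their factors dominate a product of values of r over distinct elements,
    which is at least c. *)
Lemma cylinder_prob_ge (F : {fset edge G}) (s : edge G -> bool) (X : {fset G})
    (r : G -> R) (c : R) :
  0 <= c -> (forall g, 0 <= r g) ->
  (forall A : {fset G}, c <= \prod_(g <- A) r g) ->
  (forall e, e \in F -> exists2 x, x \in X & x \in val e) ->
  (forall e x y, e \in F -> x \in X -> val e = [fset x; y]%fset ->
     r (x * y^-1)%g <= edge_weight s e) ->
  c ^+ #|` X| <= fine (Pr (cylinder F s)).
Proof.
move=> c0 r0 cr FX rs; rewrite Pr_product /=.
apply: (@le_trans _ _
  (\prod_(x <- X) \prod_(e <- F | x \in val e) edge_weight s e)).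
  have -> : c ^+ #|` X| = \prod_(x <- X) c.
    by rewrite big_const_seq count_predT iter_mulr_1.
  rewrite big_seq [leRHS]big_seq; apply: ler_prod => x xX; rewrite c0 /=.
  have /choice[other oE] : forall e : edge G, exists y,
      x \in val e -> val e = [fset x; y]%fset.
    move=> e; have [/other_end[y yE]|xe] := boolP (x \in val e).
      by exists y.
    by exists x.
  pose Fx := [fset e in F | x \in val e]%fset.
  apply: le_trans (cr [fset (x * (other e)^-1)%g | e in Fx]%fset) _.
  rewrite big_imfset/=; last first.
    move=> e e'; rewrite !inE /= => /andP[_ xe] /andP[_ xe'].
    move=> /mulgI/invg_inj oo; apply/val_inj; rewrite (oE _ xe) (oE _ xe').
    by rewrite oo.
  have -> : \prod_(e <- F | x \in val e) edge_weight s e =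
            \prod_(e <- Fx) edge_weight s e by rewrite big_fset.
  rewrite big_seq [leRHS]big_seq.
  apply: ler_prod => e; rewrite !inE/= => /andP[eF xe]; rewrite r0 /=.
  exact: rs (oE _ xe).
(* Each edge now carries its weight to the power of the number of its ends
   in X, which is at least 1. *)
rewrite (exchange_big_dep xpredT) //=.
rewrite big_seq [leRHS]big_seq; apply: ler_prod => e eF.
have /andP[w0 w1] := edge_weight01 s e.
apply/andP; split; first by rewrite prodr_ge0.
have [x xX xe] := FX _ eF.
rewrite (big_rem x xX) /= xe -[leRHS]mulr1 ler_wpM2l// prodr_ile1// => y _.
by rewrite w0.
Qed.

Hypothesis p_summable : summable [set: G] (fun x => (p x)%:E).

(** Positivity of the infinite product of the [1 - p g], in terms of finite
    products. Outside a finite set L, p sums to at most 1/2, and there the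
    product is at least 1 minus that sum. The elements of V may stand for edges
    that are required to be open, so their factor is below both p and 1 - p. *)
Lemma finite_products_ge (V : {fset G}) :
  exists2 c : R, 0 < c & forall A : {fset G},
    c <= \prod_(g <- A) (if g \in V then p g * (1 - p g) else 1 - p g).
Proof.
have h0 : 0 < (2^-1 : R) by rewrite invr_gt0.
have [K Ktail] := summable_tail p_ge0 p_summable h0.
pose r g := if g \in V then p g * (1 - p g) else 1 - p g.
have r01 g : 0 < r g <= 1.
  have /andP[p0 p1] := p_bounds g; rewrite /r; case: ifP => _; last by lra.
  by rewrite mulr_gt0 ?subr_gt0//= mulr_ile1//; lra.
have rge0 g : 0 <= r g by have /andP[/ltW] := r01 g.
pose L := (K `|` V)%fset.
exists ((\prod_(g <- L) r g) / 2).
  by rewrite divr_gt0// prodr_gt0// => g _; have /andP[] := r01 g.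
move=> A; rewrite [leRHS](bigID (mem L))/=; apply: ler_pM => //.
- by rewrite prodr_ge0.
- rewrite (bigID (mem A) xpredT)/=.
  have -> : \prod_(g <- L | g \in A) r g = \prod_(g <- A | g \in L) r g.
    by apply: eq_big_fset_cond => g; rewrite andbC.
  rewrite -[leRHS]mulr1 ler_wpM2l ?prodr_ge0// prodr_ile1// => g _.
  by rewrite rge0; have /andP[] := r01 g.
rewrite (eq_bigr (fun g => 1 - p g)); last first.
  by move=> g; rewrite !inE negb_or => /andP[_ /negPf->].
rewrite -big_filter; apply: le_trans (prod_one_minus_ge _); last first.
  by move=> g _; have /andP[/ltW-> /ltW->] := p_bounds g.
have := Ktail [fset g in A | g \notin L]%fset.
rewrite big_filter.
set F := [fset g in A | _]%fset.
have -> : \sum_(g <- F | g \notin K) p g = \sum_(g <- A | g \notin L) p g.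
  apply: eq_big_fset_cond => g; rewrite !inE /= negb_or.
  by case: (g \in K) => //=; rewrite ?andbF ?andbT// andbC.
by lra.
Qed.

End EdgeProbabilities.

(** * Planted copies of a finite subgraph *)

Section PlantedCopies.
Context {R : realType} {G : groupType}.
Implicit Types (V Q : {fset G}) (ES : {fset edge G}) (t : G).

Definition right_translate V t : {fset G} := [fset (v * t)%g | v in V]%fset.

Lemma right_translateE V t x :
  (x \in right_translate V t) = ((x * t^-1)%g \in V).
Proof.
apply/imfsetP/idP => [[v /= vV ->]|xV]; first by rewrite mulgK.
by exists (x * t^-1)%g; rewrite ?mulgVK.
Qed.

Definition edges_touching Q (X : {fset G}) : {fset edge G} :=
  [fset e in edges_within (fun=> true) Q | has (fun x => x \in val e) X]%fset.

(** The edge, moved back by t, belongs to ES. This compares two-element sets of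
    vertices, because the translate of an edge is a term of type [edge G] only
    together with a proof. *)
Definition planted ES t (e : edge G) : bool :=
  right_translate (val e) t^-1%g \in [seq val e' | e' <- ES].

(** The graph induced on Q agrees with the translate of (V, ES) on all edges
    that touch V t: those inside V t are open or closed as in ES, and those
    leaving V t are closed. *)
Definition copy_event V ES Q t : set (@configurations G) :=
  cylinder (edges_touching Q (right_translate V t)) (planted ES t).

Lemma planted_adjacent ES t (e : edge G) (x y : G) : val e = [fset x; y]%fset ->
  planted ES t e =
  adjacent (fun e => e \in ES) (x * t^-1)%g (y * t^-1)%g.
Proof.
move=> ee; rewrite /planted ee.
have -> : right_translate [fset x; y]%fset t^-1%g =
    [fset (x * t^-1)%g; (y * t^-1)%g]%fset.
  apply/fsetP => z; rewrite right_translateE invgK !inE.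
  by rewrite -!(can2_eq (mulgK t) (mulgVK t)).
apply/mapP/adjacentP => [[e' e'ES e'E]|[e' e'E e'ES]]; by exists e'.
Qed.

Lemma copy_event_adjacent V ES Q t w (x y : G) :
  copy_event V ES Q t w -> {in V, forall v, (v * t)%g \in Q} ->
  (x * t^-1)%g \in V -> y \in Q ->
  adjacent w x y = adjacent (fun e => e \in ES) (x * t^-1)%g (y * t^-1)%g.
Proof.
move=> wt VtQ xV yQ; have [<-|/pair_edge[e ee]] := eqVneq x y.
  by rewrite !adjacentxx.
rewrite (adjacent_edge _ ee) -(planted_adjacent _ _ ee); apply: wt.
have xQ : x \in Q by rewrite -(mulgVK t x) VtQ.
rewrite !inE /= mem_pmap_sub fpowersetE andbT; apply/andP; split.
  by apply/fsubsetP => z; rewrite ee !inE => /orP[] /eqP->.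
have xVt : x \in right_translate V t by rewrite right_translateE.
by apply/hasP; exists x => //; rewrite ee !inE eqxx.
Qed.

(** The lower bound is uniform in Q and t because it only involves, for each of
    the |V| vertices of the copy, a product over distinct displacements. Only
    displacements in V V^-1 can belong to an open edge of the copy. *)
Lemma copy_event_prob_ge (p : G -> R) (Pr : probability (@configurations G) R)
    V ES : (forall x, 0 < p x < 1) -> (forall x, p x = p (x^-1)%g) ->
  is_product_measure p Pr -> summable [set: G] (fun x => (p x)%:E) ->
  is_subgraph V ES ->
  exists2 q : R, 0 < q & forall Q t, q <= fine (Pr (copy_event V ES Q t)).
Proof.
move=> p_bounds p_sym Pr_product p_sum VES.
pose W := fset_mul V (fset_inv V).
have [c c0 cW] := finite_products_ge p_bounds p_sum W.
exists (c ^+ #|` V|) => [|Q t]; first exact: exprn_gt0.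
have -> : #|` V| = #|` right_translate V t|.
  by rewrite card_imfset//=; exact: mulIg.
apply: (cylinder_prob_ge p_bounds Pr_product (ltW c0) _ cW) => [g|e|e x y].
- have /andP[p0 p1] := p_bounds g.
  by case: ifP => _; rewrite ?mulr_ge0 ?subr_ge0 ?ltW.
- by rewrite !inE /= => /andP[_ /hasP[x xX xe]]; exists x.
move=> _ _ ee; rewrite /edge_weight (edge_probE p_sym ee).
have /andP[p0 p1] := p_bounds (x * y^-1)%g.
case: (boolP (planted _ _ _)) => [|_]; last first.
  by case: ifP => _; [rewrite ler_piMl ?subr_ge0 ?ltW|exact: lexx].
rewrite (planted_adjacent _ _ ee) => /(subgraph_adjacent VES)/andP[xV yV].
rewrite ifT; first by rewrite ler_piMr ?(ltW p0)// gerBl ltW.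
apply/imfset2P; exists (x * t^-1)%g => //; exists (y * t^-1)^-1%g.
  by apply/imfsetP; exists (y * t^-1)%g.
by rewrite invgM invgK mulgA mulgVK.
Qed.

(** Separation of the single point v suffices for independence of eigenfunctions
    that do not vanish at v, and a site rules out at most 2|V| points, itself
    included. *)
Lemma planting_sites V v : v \in V -> forall X : {fset G},
  exists T : {fset G}, [/\ (T `<=` X)%fset,
    {in T &, forall t t', t != t' -> (v * t' * t^-1)%g \notin V} &
    (#|` X| <= (#|` V|).*2 * #|` T|)%N].
Proof.
move=> vV X.
pose conf t t' := ((v * t' * t^-1)%g \in V) || ((v * t * t'^-1)%g \in V).
have confC : symmetric conf by move=> t t'; rewrite /conf orbC.
have [|T [TX Tconf XT]] := @independent_fset _ conf (#|` V|).*2 X confC.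
  move=> t tX; apply: (@leq_trans (size ([seq (v^-1 * (u * t))%g | u <- V] ++
      [seq (u^-1 * (v * t))%g | u <- V]))); last first.
    by rewrite size_cat !size_map addnn.
  apply: uniq_leq_size => [|t']; first exact: fset_uniq.
  rewrite !inE /= mem_cat => /andP[_ t't].
  have {t't} /orP[t'V|t'V] : conf t t'.
    by case/orP: t't => [/eqP->|//]; rewrite /conf mulgK vV.
  - apply/orP; left; apply/mapP; exists (v * t' * t^-1)%g => //.
    by rewrite mulgVK mulKg.
  - apply/orP; right; apply/mapP; exists (v * t * t'^-1)%g => //.
    by rewrite !invgM !invgK -!mulgA mulKg mulVg mulg1.
exists T; split => // t t' tT t'T tt'.
by have := Tconf t t' tT t'T tt'; rewrite negb_or => /andP[].
Qed.

(** The left side is the number of sites t of T at which a copy occurs. *)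
Lemma planted_eigenspace V ES (a : R) (f : G -> R) v Q (T : {fset G}) w :
  is_subgraph V ES -> eigenfunction_on V ES a f ->
  (forall x, x \notin V -> f x = 0) -> v \in V -> f v != 0 ->
  (T `<=` interior_points V Q)%fset ->
  {in T &, forall t t', t != t' -> (v * t' * t^-1)%g \notin V} ->
  (#|` T|%:R : R) - \sum_(t <- T) \1_(~` copy_event V ES Q t) w <=
  (\rank (eigenspace (lin1_mx (graph_laplacian (V := Q) (edges_within w Q))) a))%:R.
Proof.
move=> VES fa f0 vV fv TQ Tindep.
have VtQ t : t \in T -> {in V, forall u, (u * t)%g \in Q}.
  by move=> /(fsubsetP TQ); rewrite !inE => /andP[_ /allP].
pose T' := [fset t in T | w \in copy_event V ES Q t]%fset.
have -> : #|` T|%:R - \sum_(t <- T) \1_(~` copy_event V ES Q t) w =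
    #|` T'|%:R :> R.
  rewrite [in RHS]card_fset_sum1 natr_sum big_fset /= [RHS]big_mkcond /=.
  rewrite card_fset_sum1 natr_sum -sumrB; apply: eq_bigr => t _.
  by rewrite indicE in_setC; case: (w \in _); rewrite ?subr0 ?subrr.
rewrite ler_nat.
have T'T t : t \in T' -> t \in T /\ copy_event V ES Q t w.
  by rewrite !inE /= => /andP[tT]; rewrite inE.
apply: (@rank_eigenspace_family _ _ _ _ _ _ (fun t x => f (x * t^-1)%g)
  (fun t => (v * t)%g)).
- move=> t /T'T[tT wt]; apply: (eigenfunction_translate VES) => //.
    exact: VtQ.
  move=> x y xV yQ; exact: (copy_event_adjacent wt (VtQ t tT)).
- by move=> t /T'T[tT _]; exact: (VtQ t).
- by move=> t _; rewrite mulgK.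
- by move=> t t' /T'T[tT _] /T'T[t'T _] tt'; rewrite f0// Tindep.
Qed.

End PlantedCopies.

(** * The jumps of the integrated density of states *)

Lemma uniform_near (R : realType) (f : nat -> R -> R) (N : R -> R) (d : R) :
  {uniform, f @ \oo --> N} -> 0 < d ->
  \forall j \near \oo, forall E, `|N E - f j E| < d.
Proof.
move=> fN d0.
have /= := fN [set h | forall y, [set: R] y -> ball (N y) d (h y)].
case.
  apply/uniform_nbhs; exists [set xy | ball xy.1 d xy.2]; split => //.
  exact: (entourage_ball _ (PosNum d0)).
by move=> n _ nf; exists n => // j nj E; exact: (nf j nj).
Qed.

(** A leaking vertex either lies near the boundary, measured by the short
    displacements, or has a long edge. The first term is deterministic and the
    second involves only events attached to single vertices. *)
Lemma leaking_le (R : realType) (G : groupType) (w : edge G -> bool)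
    (Q K : {fset G}) :
  #|` leaking w Q|%:R <= #|` Q `\` interior_points (fset_inv K) Q|%fset%:R
    + \sum_(x <- Q) \1_(long_edge K x) w :> R.
Proof.
have -> : \sum_(x <- Q) \1_(long_edge K x) w =
    #|` [fset x in Q | w \in long_edge K x]|%fset%:R :> R.
  rewrite card_fset_sum1 natr_sum big_fset /= [RHS]big_mkcond /=.
  by apply: eq_bigr => x _; rewrite indicE; case: (_ \in _).
rewrite -natrD ler_nat -cardfsUI; apply: leq_trans (leq_addr _ _).
apply: fsubset_leq_card; apply/fsubsetP => x.
rewrite !inE /= => /andP[xQ /asboolP[y yQ xy]]; rewrite xQ/= andbT.
have [xyK|xyK] := boolP ((x * y^-1)%g \in K); last first.
  by apply/orP; right; rewrite inE; exists y.
apply/orP; left; apply/allPn; exists (y * x^-1)%g; last by rewrite mulgVK.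
by apply/imfsetP; exists (x * y^-1)%g => //; rewrite invgM invgK.
Qed.

Section DensityOfStates.
Context {R : realType} {G : groupType}.
Variables (P : {fset G}) (Q : nat -> {fset G}) (p : G -> R).
Variables (Pr : probability (@configurations G) R) (N : R -> R).
Hypothesis P_generates : generates P.
Hypothesis Q_Folner : Folner_sequence (R := R) Q.
Hypothesis p_summable : summable [set: G] (fun x => (p x)%:E).
Hypothesis p_bounds : forall x, 0 < p x < 1.
Hypothesis p_symmetric : forall x, p x = p (x^-1)%g.
Hypothesis Pr_product : is_product_measure p Pr.
Hypothesis N_IDS : is_IDS Pr Q N.

Let card_gt0 j : 0 < #|` Q j|%:R :> R.
Proof. by rewrite ltr0n cardfs_gt0; exact: Q_Folner.1. Qed.

Let laplacian j w : 'M[R]_#|` Q j| :=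
  lin1_mx (graph_laplacian (V := Q j) (edges_within w (Q j))).

Let count j w (E : R) := (eigenvalue_count (restricted_laplacian w (Q j)) E)%:R
  / #|` Q j|%:R : R.

Lemma rank_restricted_le w j (a : R) :
  (\rank (eigenspace (restricted_laplacian w (Q j)) a) <=
   \rank (eigenspace (laplacian j w) a) + #|` leaking w (Q j)|)%N.
Proof.
apply: leq_trans (rank_eigenspace_perturbation _ (laplacian j w) _) _.
by rewrite leq_add2l rank_restricted_laplacian.
Qed.

Lemma rank_laplacian_le w j (a : R) :
  (\rank (eigenspace (laplacian j w) a) <=
   \rank (eigenspace (restricted_laplacian w (Q j)) a) + #|` leaking w (Q j)|)%N.
Proof.
apply: leq_trans
  (rank_eigenspace_perturbation _ (restricted_laplacian w (Q j)) _) _.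
by rewrite leq_add2l -mxrank_opp opprB rank_restricted_laplacian.
Qed.

(** By translation invariance the same K serves all vertices. *)
Lemma rare_long_edges (d : R) : 0 < d -> exists K : {fset G},
  forall x, measurable (long_edge K x) /\ fine (Pr (long_edge K x)) <= d.
Proof.
move=> d0.
have p0 x : 0 <= p x by have /andP[/ltW] := p_bounds x.
have [K tail] := summable_tail p0 p_summable d0; exists K => x.
have [mE PE] :=
  long_edge_event p_bounds p_symmetric Pr_product x P_generates tail.
by split => //; rewrite -lee_fin fineK ?fin_num_measure.
Qed.

(** Otherwise almost surely, for all large j, the multiplicity of a exceeds
    [d |Q j|]; but it is at most the number of leaking vertices, whose expected
    proportion tends to 0. *)
Lemma exists_small_eigenspace (a d : R) :
  ~ finite_subgraph_spectra (G := G) a -> 0 < d ->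
  exists w j, (forall E, `|N E - count j w E| < d) /\
    (\rank (eigenspace (restricted_laplacian w (Q j)) a))%:R <= d * #|` Q j|%:R.
Proof.
move=> aW d0; apply: contrapT => none.
have d4 : 0 < d / 4 by rewrite divr_gt0.
have [K Kprop] := rare_long_edges d4.
pose c j : R :=
  #|` Q j `\` interior_points (fset_inv K) (Q j)|%fset%:R / #|` Q j|%:R.
suff : d <= d / 4 + d / 4 by lra.
apply: (@fatou_indicators _ _ _ Pr (fun j => [seq long_edge K x | x <- Q j]) c
   (fun j => #|` Q j|%:R)).
- by move=> j A /mapP[x _ ->]; have [] := Kprop x.
- by move=> j; rewrite divr_ge0.
- by [].
- exact: ltW.
- move: N_IDS; apply: filterS => w wN; near=> j.
  rewrite big_map -mulrDl ler_pdivlMr//.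
  apply: le_trans (leaking_le _ _ _ _).
  apply: ltW; rewrite ltNge; apply/negP => leak; apply: none.
  exists w, j; split; first by near: j; exact: uniform_near.
  apply: le_trans leak; rewrite ler_nat.
  apply: leq_trans (rank_restricted_le _ _ _) _.
  rewrite notin_spectrum_rank// => aL; apply: aW.
  exists (Q j), (edges_within w (Q j)); split => // e.
  by rewrite in_edges_within => /andP[].
- near=> j; apply: lerD.
    by rewrite ler_pdivrMr//; near: j; exact: Folner_interior.
  rewrite big_map ler_pdivrMr//.
  apply: (@le_trans _ _ (\sum_(x <- Q j) d / 4)).
    by apply: ler_sum => x _; have [] := Kprop x.
  by rewrite big_const_seq count_predT iter_addr_0 mulr_natr.
Unshelve. all: by end_near. Qed.

Lemma discontinuities_sub :
  discontinuities N `<=` finite_subgraph_spectra (G := G).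
Proof.
move=> a; apply: contra_notP => aW; apply/cvgrPdist_lt => e e0.
have e4 : 0 < e / 4 by rewrite divr_gt0.
have [w [j [Nj rk]]] := exists_small_eigenspace aW e4.
have [d d0 near_a] := eigenvalue_count_near (restricted_laplacian w (Q j)) a.
near=> E.
have Ed : `|E - a| < d.
  by rewrite distrC; near: E; exact: (nbhsx_ballx a d d0).
have cE : `|count j w E - count j w a| <= e / 4.
  rewrite /count -mulrBl normrM [X in _ * X]ger0_norm ?invr_ge0// ler_pdivrMr//.
  exact: le_trans (near_a _ Ed) rk.
have := Nj E; have := Nj a; move: cE.
rewrite ler_norml !ltr_norml => /andP[? ?] /andP[? ?] /andP[? ?].
by lra.
Unshelve. all: by end_near. Qed.

(** Compare the values of N at a and at a point E slightly to the left of a: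
    between them the counting functions increase by at least the multiplicity
    of a. *)
Lemma continuous_rank_small (a d : R) : {for a, continuous N} -> 0 < d ->
  {ae Pr, forall w : @configurations G, \forall j \near \oo,
    (\rank (eigenspace (restricted_laplacian w (Q j)) a))%:R
      <= d * #|` Q j|%:R}.
Proof.
move=> Na d0; have d3 : 0 < d / 3 by rewrite divr_gt0.
have [E Ea NE] : exists2 E, E < a & `|N a - N E| < d / 3.
  move/cvgrPdist_lt : Na => /(_ _ d3)[e /= e0 eN].
  exists (a - e / 2); first by rewrite ltrBlDr ltrDl divr_gt0.
  apply: eN => /=; rewrite /ball/= opprB addrC subrK ger0_norm ?divr_ge0 ?ltW//.
  by rewrite gtr_pMr// invf_lt1// ltr1n.
move: N_IDS; apply: filterS => w wN; near=> j.
have Nj : forall E, `|N E - (eigenvalue_count (restricted_laplacian w (Q j)) E)%:R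
    / #|` Q j|%:R| < d / 3 by near: j; exact: uniform_near.
have Qj := card_gt0 j; rewrite -ler_pdivrMr//.
have := eigenvalue_count_jump (restricted_laplacian w (Q j)) Ea.
rewrite -(ler_nat R) natrD => /(ler_wpM2r (ltW (_ : 0 < #|` Q j|%:R^-1))).
rewrite invr_gt0 => /(_ Qj); rewrite mulrDl.
move: NE (Nj E) (Nj a); rewrite !ltr_norml => /andP[? ?] /andP[? ?] /andP[? ?].
by lra.
Unshelve. all: by end_near. Qed.

(** At least a fraction k of the points of [Q j] is expected to carry a copy of
    the given subgraph. If N were continuous at a, almost surely and for large j
    the proportion of copies would exceed that of the leaking vertices by at
    most d. Fatou is applied to the sites without a copy together with the
    vertices with a long edge, so that all terms are nonnegative. *)
Lemma spectra_sub_discontinuities :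
  finite_subgraph_spectra (G := G) `<=` discontinuities N.
Proof.
move=> a [V [ES [VES aS]]] Na.
have balance (n t i s1 s2 d k q : R) : i <= d * n -> k * n <= q * t ->
  s1 <= (1 - q) * t -> s2 <= d * n ->
  n - t + i + (s1 + s2) <= (1 - k + d + d) * n by lra.
have [f [f0 [v vV fv] fa]] := spectrum_eigenfunction aS.
have [q q0 qP] :=
  copy_event_prob_ge p_bounds p_symmetric Pr_product p_summable VES.
have /choice[T TP] := fun j => planting_sites vV (interior_points V (Q j)).
have V0 : 0 < (#|` V|.*2)%:R :> R.
  by rewrite ltr0n double_gt0 cardfs_gt0; apply/fset0Pn; exists v.
(* For large j half of the points of [Q j] are interior, at least one in 2|V|
   of those is a site, and a site carries a copy with probability at least q. *)
pose k := q / 2 / (#|` V|.*2)%:R.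
have k0 : 0 < k by rewrite !divr_gt0.
(* Small enough that the three errors of size d cannot make up for k; at most 1
   so that the lower bound 1 - d in Fatou is nonnegative. *)
pose d := Num.min (k / 8) 1.
have d0 : 0 < d by rewrite lt_min ltr01 divr_gt0.
have dk : d <= k / 8 by rewrite ge_min lexx.
have d1 : d <= 1 by rewrite ge_min lexx orbT.
have [K Kprop] := rare_long_edges d0.
pose c j : R := 1 - #|` T j|%:R / #|` Q j|%:R +
  #|` Q j `\` interior_points (fset_inv K) (Q j)|%fset%:R / #|` Q j|%:R.
pose s j := [seq ~` copy_event V ES (Q j) t | t <- T j] ++
            [seq long_edge K x | x <- Q j].
have mcopy Q' t : measurable (copy_event V ES Q' t).
  exact: measurable_cylinder.
have TQ j : (T j `<=` interior_points V (Q j))%fset by have [] := TP j.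
have cardTQ j : #|` T j|%:R <= #|` Q j|%:R :> R.
  rewrite ler_nat fsubset_leq_card//; apply: fsubset_trans (TQ j) _.
  by apply/fsubsetP => x; rewrite !inE => /andP[].
have cE j (x : R) : c j + x / #|` Q j|%:R = (#|` Q j|%:R - #|` T j|%:R +
    #|` Q j `\` interior_points (fset_inv K) (Q j)|%fset%:R + x) / #|` Q j|%:R.
  by rewrite /c !mulrDl mulNr divff ?gt_eqF.
suff : 1 - d <= 1 - k + d + d by lra.
apply: (@fatou_indicators _ _ _ Pr s c (fun j => #|` Q j|%:R)).
- move=> j A; rewrite mem_cat => /orP[] /mapP[x _ ->].
    by apply: measurableC; exact: mcopy.
  by have [] := Kprop x.
- by move=> j; rewrite addr_ge0 ?divr_ge0// subr_ge0 ler_pdivrMr// mul1r.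
- by [].
- by rewrite subr_ge0.
- move: (continuous_rank_small Na d0); apply: filterS => w wrk; near=> j.
  have rkM : (\rank (eigenspace (restricted_laplacian w (Q j)) a))%:R
      <= d * #|` Q j|%:R by near: j.
  have [_ Tindep _] := TP j.
  have := planted_eigenspace w VES fa f0 vV fv (TQ j) Tindep.
  have := rank_laplacian_le w j a; rewrite -(ler_nat R) natrD.
  have := leaking_le R w (Q j) K.
  rewrite cE /s big_cat /= !big_map ler_pdivlMr//.
  by move: rkM; lra.
- near=> j.
  have [_ _ cardT] := TP j.
  have iK : #|` Q j `\` interior_points (fset_inv K) (Q j)|%fset%:R
      <= d * #|` Q j|%:R by near: j; exact: Folner_interior.
  have iV : #|` Q j `\` interior_points V (Q j)|%fset%:R
      <= 2^-1 * #|` Q j|%:R :> R.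
    by near: j; apply: Folner_interior => //; rewrite invr_gt0.
  have kT : k * #|` Q j|%:R <= q * #|` T j|%:R.
    rewrite /k mulrAC ler_pdivrMr// -!mulrA ler_pM2l//.
    move: cardT; rewrite -(ler_nat R) natrM.
    have := cardfsID (interior_points V (Q j)) (Q j).
    rewrite (fsetIidPr _); last first.
      by apply/fsubsetP => x; rewrite !inE => /andP[].
    move/(congr1 (fun n => n%:R : R)); rewrite natrD [X in _ <= X]mulrC.
    by move: iV; lra.
  rewrite cE /s big_cat /= !big_map ler_pdivrMr//.
  have sum_cst (B : {fset G}) (x : R) : \sum_(y <- B) x = x * #|` B|%:R.
    by rewrite big_const_seq count_predT iter_addr_0 mulr_natr.
  apply: balance iK kT _ _; rewrite -sum_cst; apply: ler_sum => x _.
    rewrite probability_setC// fineB ?fin_num_measure//.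
    by rewrite lerD2l lerN2; exact: qP.
  by have [] := Kprop x.
Unshelve. all: by end_near. Qed.

End DensityOfStates.

Theorem corollary6p2 (R : realType) (G : groupType) (P : {fset G})
    (Q : nat -> {fset G}) (p : G -> R)
    (Pr : probability (@configurations G) R) (N : R -> R)
    (G_amenable : amenable R G)
    (P_symmetric : symmetric_fset P)
    (P_generates : generates P)
    (Q_Folner : Folner_sequence (R := R) Q)
    (Q_tempered : tempered (R := R) Q)
    (Q_increasing : strictly_increasing Q)
    (Q_monotile : forall n, monotile (Q n))
    (p_summable : summable [set: G] (fun x => (p x)%:E))
    (p_bounds : forall x, 0 < p x < 1)
    (p_symmetric : forall x, p x = p (x^-1)%g)
    (Pr_product : is_product_measure p Pr)
    (N_IDS : is_IDS Pr Q N) :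
  discontinuities N = finite_subgraph_spectra (G := G).
Proof.
apply/seteqP; split.
  exact: (discontinuities_sub P_generates Q_Folner p_summable p_bounds
    p_symmetric Pr_product N_IDS).
exact: (spectra_sub_discontinuities P_generates Q_Folner p_summable p_bounds
    p_symmetric Pr_product N_IDS).
Qed.
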